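(* Let $p$ be an odd prime, let $a$ be a positive integer, and let $m$ be an integer not divisible by $p$. Then $$\sum_{k=0}^{(p^a-1)/2}\frac{\binom{2k}{k}}{m^k}\equiv\left(\frac{m(m-4)}{p^a}\right)+\left(\frac{-m}{p}\right)\left(\frac{m(m-4)}{p^{a-1}}\right)\bar m\, u_{p-(\frac{4-m}{p})}(4,m)\pmod{p^2},$$ where $\bar m=1$ if $m\equiv 4\pmod p$, $\bar m=2$ if $\left(\frac{4-m}{p}\right)=1$, and $\bar m=2/m$ if $\left(\frac{4-m}{p}\right)=-1$. Moreover $$\sum_{k=0}^{(p^a-1)/2}\frac{C_k}{m^k}\equiv\frac{4-m}{2}\sum_{k=0}^{(p^a-1)/2}\frac{\binom{2k}{k}}{m^k}+\frac m2-2p\,\delta_{a,1}\left(\frac{-m}{p}\right)\pmod{p^2}.$$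
   Context: For integers $A,B$, the Lucas sequence $u_n=u_n(A,B)$ is defined by $u_0=0$, $u_1=1$, $u_{n+1}=Au_n-Bu_{n-1}$ for $n\ge1$. $C_k=\frac{1}{k+1}\binom{2k}{k}$ is the $k$-th Catalan number. $\left(\frac{\cdot}{\cdot}\right)$ is the Jacobi symbol, and $\delta_{a,1}$ is the Kronecker delta. Congruences between rational numbers whose denominators are prime to $p$ are understood in the ring of rationals with denominator prime to $p$. *)

(* Defs.v *)
From mathcomp Require Import all_boot all_order all_algebra.

Set Implicit Arguments.
Unset Strict Implicit.
Unset Printing Implicit Defensive.

Import Order.TTheory GRing.Theory Num.Theory.

Local Open Scope ring_scope.

Fixpoint lucas_u (A B : int) (n : nat) : int :=
  match n with
  | 0%N => 0
  | 1%N => 1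
  | (n'.+1 as n1).+1 => A * lucas_u A B n1 - B * lucas_u A B n'
  end.

Definition catalan (k : nat) : rat := 'C(k.*2, k)%:R / k.+1%:R.

(* Meaningful for q an odd prime. *)
Definition legendre (x : int) (q : nat) : int :=
  if (q%:Z %| x)%Z then 0
  else if [exists y : 'I_q, (y%:Z ^+ 2 == x %[mod q%:Z])%Z] then 1
  else -1.

(* Meaningful for n odd and positive; the empty product gives (x / 1) = 1,
   also when x = 0. *)
Definition jacobi (x : int) (n : nat) : int :=
  \prod_(q <- primes n) legendre x q ^+ logn q n.

Definition p_integral (p : nat) (x : rat) : bool := coprime p `|denq x|.

(* x = y modulo N in the ring of rationals with denominator prime to p. *)
Definition rat_congr (p N : nat) (x y : rat) : Prop :=
  [/\ p_integral p x, p_integral p y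
    & exists2 z : rat, p_integral p z & x - y = N%:R * z].

(* When p does not divide m - 4, the symbol is 1 or -1, so the last branch is
   the case of the symbol -1. *)
Definition mbar (p : nat) (m : int) : rat :=
  if (m == 4 %[mod p%:Z])%Z then 1
  else if jacobi (4 - m) p == 1 then 2
  else 2 / m%:~R.

(* Main.v *)
(** Write D = 4 - m, e = ((4 - m) / p), s = (- m / p) and q = p^a = 2 N + 1.
    The quotient of (-16)^k C(N + k, 2k) by C(2k, k) is the product of the
    factors 1 - q^2 / (2j - 1)^2, each of which is 1 modulo p^2; hence the
    first sum is congruent to sum_k C(N + k, 2k) (-16 / m)^k, a Morgan-Voyce
    polynomial whose value is u_q(4, m) / (- m)^N.

    With alpha = 2 + sqrt D, the number u_k is the sqrt D-coordinate of alpha^k.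
    Frobenius gives alpha^p = 2 + e sqrt D modulo p; raising this to the power
    p^a gives u_(p^(a+1)) = e u_(p^a) modulo p^2 for a > 0, which reduces
    everything to a = 1.  There p divides u_(p - e), so the norm equation
    x^2 - D u^2 = m^(p - e) determines the rational coordinate x of
    alpha^(p - e) modulo p^2, and with it u_p.

    The Catalan sum telescopes because C_k = 2 C(2k, k) - C(2k + 1, k + 1). *)

Require Import Defs.
From HB Require Import structures.
From mathcomp Require Import all_boot all_order all_algebra all_field.
From mathcomp Require Import ring zify.

Set Implicit Arguments.
Unset Strict Implicit.
Unset Printing Implicit Defensive.

Import Order.TTheory GRing.Theory Num.Theory.

Local Open Scope ring_scope.

(** * Powers modulo p and the Legendre symbol *)

(** The inner binomial coefficients are multiples of p. The error term is explicit because the lemma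
    is applied in Z[sqrt D], whose characteristic is 0. *)
Lemma exprD_prime (R : comNzRingType) (p : nat) (x y : R) : prime p ->
  exists z, (x + y) ^+ p = x ^+ p + y ^+ p + p%:R * z.
Proof.
move=> p_pr; have p_gt0 := prime_gt0 p_pr.
have Hb (i : 'I_p.-1) : ('C(p, i.+1) = p * ('C(p, i.+1) %/ p))%N.
  rewrite mulnC divnK //; apply: prime_dvd_bin => //=.
  by rewrite -ltn_predRL.
exists (\sum_(i < p.-1) x ^+ (p - i.+1) * y ^+ i.+1 *+ ('C(p, i.+1) %/ p)).
rewrite exprDn big_ord_recl /= subn0 bin0 mulr1 mulr1n -addrA; congr (_ + _).
case: p p_pr p_gt0 Hb => // p _ _ Hb.
rewrite big_ord_recr /= /bump /= add1n subnn mul1r binn mulr1n addrC.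
congr (_ + _); rewrite mulr_sumr; apply: eq_bigr => i _.
by rewrite [in LHS](Hb i) mulrnA mulr_natl mulrnAC.
Qed.

Lemma expr_congr (R : comNzRingType) (N x y z : R) (k : nat) :
  x = y + N * z -> exists t, x ^+ k = y ^+ k + N * t.
Proof.
move=> xE; exists (z * \sum_(i < k) x ^+ (k.-1 - i) * y ^+ i).
have := subrXX x y k; rewrite {2}xE [y + _]addrC addrK => E.
by rewrite mulrA -E addrC subrK.
Qed.

(** In x^p - y^p = (x - y) S, the sum S has p terms, each congruent to y^(p-1) modulo p, so p
    divides S as well as x - y. *)
Lemma expr_congr_lift (R : comNzRingType) (p : nat) (x y z : R) :
  (0 < p)%N -> x = y + p%:R * z ->
  exists t, x ^+ p = y ^+ p + (p ^ 2)%:R * t.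
Proof.
move=> p_gt0 xE.
have termE (i : 'I_p) :
    exists t, x ^+ (p.-1 - i) * y ^+ i = y ^+ p.-1 + p%:R * t.
  have [w wE] := expr_congr (p.-1 - i) xE.
  exists (w * y ^+ i); rewrite wE mulrDl -exprD subnK ?mulrA //.
  by rewrite -ltnS prednK.
have [t tE] := fin_all_exists termE.
exists (z * (y ^+ p.-1 + \sum_(i < p) t i)).
have := subrXX x y p; rewrite {2}xE [y + _]addrC addrK => E.
rewrite -[LHS](subrK (y ^+ p)) E (eq_bigr _ (fun i _ => tE i)).
rewrite big_split /= sumr_const card_ord -mulr_sumr.
by rewrite natrX -mulr_natl; ring.
Qed.

Lemma expr_congr_sqr (R : comNzRingType) (p a : nat) (x y z : R) :
  (0 < p)%N -> (0 < a)%N -> x = y + p%:R * z ->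
  exists t, x ^+ (p ^ a) = y ^+ (p ^ a) + (p ^ 2)%:R * t.
Proof.
case: a => // a p_gt0 _ /(expr_congr_lift p_gt0)[t tE].
by rewrite expnS !exprM; apply: expr_congr tE.
Qed.

Lemma dvdz_subP (p : nat) (x y : int) :
  (p%:Z %| x - y)%Z <-> exists z, x = y + p%:R * z.
Proof.
split=> [/dvdzP[z zE] | [z ->]].
  by exists z; rewrite natz mulrC -zE addrC subrK.
by rewrite [y + _]addrC addrK natz dvdz_mulr.
Qed.

Section OddPrime.

Variable p : nat.
Hypotheses (p_pr : prime p) (p_odd : odd p).
Let p_gt0 := prime_gt0 p_pr.
Let p_gt1 := prime_gt1 p_pr.
Let n := p.-1./2.

Lemma odd_prime_half : p = n.*2.+1.
Proof. by move: p_odd; rewrite /n; lia. Qed.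

Lemma odd_prime_ge3 : (2 < p)%N.
Proof. by move: p_gt1 p_odd; case: p => [|[|[|]]]. Qed.

Let p_char : p \in [pchar 'F_p] := pchar_Fp p_pr.

Lemma Fp_eq_int (x y : int) :
  (x%:~R == y%:~R :> 'F_p) = (p%:Z %| x - y)%Z.
Proof. by rewrite (dvdz_pcharf p_char) rmorphB subr_eq0. Qed.

Lemma Fp_expp (x : 'F_p) : x ^+ p = x.
Proof. by rewrite -[in RHS](expf_card x) (card_Fp p_pr). Qed.

Lemma dvdz_fermat (x : int) : (p%:Z %| x ^+ p - x)%Z.
Proof.
by rewrite -Fp_eq_int rmorphXn /= Fp_expp.
Qed.

Lemma prime_dvdzM (x y : int) :
  (p%:Z %| x * y)%Z = (p%:Z %| x)%Z || (p%:Z %| y)%Z.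
Proof. by rewrite !dvdzE /= abszM Euclid_dvdM. Qed.

Lemma legendre_values (x : int) :
  [\/ (p%:Z %| x)%Z /\ legendre x p = 0,
      ~~ (p%:Z %| x)%Z /\ legendre x p = 1
    | ~~ (p%:Z %| x)%Z /\ legendre x p = -1].
Proof.
rewrite /legendre; case: ifP => _; first by constructor 1.
by case: ifP => _; [constructor 2 | constructor 3].
Qed.

(* If a nonsquare x had x^n = 1, then X^n - 1 would have the n + 1 roots
   1^2, ..., n^2, x in F_p. *)
Lemma legendre_euler (x : int) : (p%:Z %| x ^+ n - legendre x p)%Z.
Proof.
rewrite /legendre; case: ifPn => [px | npx].
  rewrite subr0; apply: dvdz_exp => //.
  by have := odd_prime_half; have := odd_prime_ge3; lia.
have x0 : x%:~R != 0 :> 'F_p by rewrite -(dvdz_pcharf p_char).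
have fermat1 (y : 'F_p) : y != 0 -> y ^+ (n.*2) = 1.
  by move=> y0; apply: (mulfI y0); rewrite mulr1 -exprS -odd_prime_half Fp_expp.
case: ifPn => [/existsP[y yE] | nsq].
  have {}yE : x%:~R = y%:~R ^+ 2 :> 'F_p.
    apply/eqP; rewrite -rmorphXn /= eq_sym Fp_eq_int.
    by rewrite -eqz_mod_dvd.
  rewrite -Fp_eq_int rmorphXn /= yE -exprM mul2n fermat1 //.
  by apply: contraNneq x0 => y0; rewrite yE y0 expr0n.
have xx : (x%:~R : 'F_p) ^+ n * (x%:~R : 'F_p) ^+ n = 1.
  by rewrite -exprD addnn fermat1.
have : ((x%:~R : 'F_p) ^+ n - 1) * ((x%:~R : 'F_p) ^+ n + 1) == 0.
  by rewrite -subr_sqr expr1n expr2 xx subrr.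
rewrite mulf_eq0 subr_eq0 => /orP[/eqP x1 | ]; last first.
  by rewrite -Fp_eq_int rmorphXn /= addr_eq0 rmorphN.
pose s := (x%:~R : 'F_p) :: [seq (i.+1%:R : 'F_p) ^+ 2 | i <- iota 0 n].
have n_gt0 : (0 < n)%N.
  by have := odd_prime_half; have := odd_prime_ge3; lia.
have small_neq0 k : (0 < k < p)%N -> k%:R != 0 :> 'F_p.
  by move=> /andP[k0 kp]; rewrite -(dvdn_pcharf p_char) gtnNdvd.
suff : (size s < size ('X^n - 1%:P : {poly 'F_p})%R)%N.
  by rewrite size_XnsubC //= size_map size_iota ltnn.
apply: max_poly_roots.
- by rewrite -size_poly_gt0 size_XnsubC.
- rewrite /= rootE !hornerE x1 subrr eqxx /=.
  apply/allP => _ /mapP[i + ->]; rewrite mem_iota add0n /= => i_lt.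
  rewrite rootE !hornerE -exprM mul2n fermat1 ?subrr //.
  by apply: small_neq0; have := odd_prime_half; lia.
- rewrite /=; apply/andP; split.
    apply: contra nsq => /mapP[i + xE]; rewrite mem_iota add0n /= => i_lt.
    have i_ltp : (i.+1 < p)%N by have := odd_prime_half; lia.
    apply/existsP; exists (Ordinal i_ltp).
    by rewrite eqz_mod_dvd -Fp_eq_int xE rmorphXn /= -pmulrn.
  (* Equal squares force i + 1 and j + 1 to be equal or opposite in F_p; the latter is excluded
     because their sum is at most 2n < p. *)
  rewrite map_inj_in_uniq ?iota_uniq // => i j.
  rewrite !mem_iota !add0n /= => i_lt j_lt /eqP.
  rewrite -subr_eq0 subr_sqr mulf_eq0 -natrD => /orP[|]; last first.
    by rewrite (negPf (small_neq0 _ _)) //; have := odd_prime_half; lia.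
  rewrite subr_eq0 => ij; have : (p%:Z %| i.+1%:Z - j.+1%:Z)%Z.
    by rewrite -Fp_eq_int -!pmulrn.
  case/dvdzP => q; have := odd_prime_half.
  by case: (ltrgtP q 0) => [q0|q0|->]; nia.
Qed.

(** Here |s - t| <= 2 < p. This turns congruences obtained from Euler's criterion into equalities of
    symbols. *)
Lemma sign_eq_mod (s t : int) : `|s| <= 1 -> `|t| <= 1 ->
  (p%:Z %| s - t)%Z -> s = t.
Proof.
move=> s1 t1 /dvdzP[q]; have := odd_prime_ge3.
by case: (ltrgtP q 0) => [q0|q0|->]; nia.
Qed.

Lemma legendre_norm (x : int) : `|legendre x p| <= 1.
Proof. by case: (legendre_values x) => -[_ ->]. Qed.

Lemma legendreM (x y : int) :
  legendre (x * y) p = legendre x p * legendre y p.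
Proof.
apply: sign_eq_mod.
- exact: legendre_norm.
- by rewrite normrM mulr_ile1 ?legendre_norm.
have /dvdzP[u uE] := legendre_euler x.
have /dvdzP[v vE] := legendre_euler y.
have /dvdzP[w wE] := legendre_euler (x * y).
apply/dvdzP; exists (u * y ^+ n + legendre x p * v - w).
rewrite !mulrDl mulNr -wE mulrAC -uE -mulrA -vE exprMn; ring.
Qed.

Lemma jacobi_prime_pow (x : int) (a : nat) :
  jacobi x (p ^ a) = legendre x p ^+ a.
Proof.
rewrite /jacobi; case: a => [|a].
  by rewrite expn0 big_nil expr0.
by rewrite primesX // primes_prime // big_seq1 pfactorK.
Qed.

Lemma jacobi_prime (x : int) : jacobi x p = legendre x p.
Proof. by rewrite -[p in LHS]expn1 jacobi_prime_pow expr1. Qed.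

(** Raising Euler's criterion to the power p^a lifts its modulus to p^2, and the symbol equals its
    own p^a-th power because p^a is odd. *)
Lemma legendre_pow_sqr (x : int) (a : nat) : (0 < a)%N ->
  (p%:Z ^+ 2 %| x ^+ (n * p ^ a) - legendre x p)%Z.
Proof.
move=> a_gt0; have /dvdz_subP[z zE] := legendre_euler x.
have [t tE] := expr_congr_sqr p_gt0 a_gt0 zE.
have odd_pa : odd (p ^ a) by rewrite oddX p_odd orbT.
have -> : x ^+ (n * p ^ a) - legendre x p = (p ^ 2)%:R * t.
  rewrite exprM tE; suff -> : legendre x p ^+ (p ^ a) = legendre x p by ring.
  case: (legendre_values x) => -[_ ->]; rewrite ?expr1n //.
    by rewrite expr0n expn_eq0 eqn0Ngt p_gt0.
  by rewrite -signr_odd odd_pa expr1.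
by rewrite natrX natz dvdz_mulr.
Qed.

End OddPrime.

(** * The ring Z[sqrt D] and the Lucas sequence *)

(* The pair (x, y) stands for x + y sqrt D in Z[sqrt D] = Z[X]/(X^2 - D). *)
Definition quad (D : int) : Type := (int * int)%type.

Section QuadraticRing.

Variable D : int.

HB.instance Definition _ := GRing.Zmodule.on (quad D).

Definition quad_one : quad D := (1, 0).

Definition quad_mul (x y : quad D) : quad D :=
  (x.1 * y.1 + D * (x.2 * y.2), x.1 * y.2 + x.2 * y.1).

Fact quad_mulA : associative quad_mul.
Proof. by move=> x y z; congr pair; rewrite /=; ring. Qed.

Fact quad_mulC : commutative quad_mul.
Proof. by move=> x y; congr pair; rewrite /=; ring. Qed.

Fact quad_mul1 : left_id quad_one quad_mul.
Proof. by case=> x y; congr pair; rewrite /=; ring. Qed.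

Fact quad_mulDl : left_distributive quad_mul +%R.
Proof. by case=> x y [z t] [u v]; congr pair; rewrite /=; ring. Qed.

Fact quad_one_neq0 : quad_one != 0.
Proof. by []. Qed.

HB.instance Definition _ := GRing.Zmodule_isComNzRing.Build (quad D)
  quad_mulA quad_mulC quad_mul1 quad_mulDl quad_one_neq0.

Lemma quadM (x y z t : int) :
  ((x, y) : quad D) * (z, t) = (x * z + D * (y * t), x * t + y * z).
Proof. by []. Qed.

Lemma quadD (x y z t : int) : ((x, y) : quad D) + (z, t) = (x + z, y + t).
Proof. by []. Qed.

Lemma quad_nat (k : nat) : k%:R = (k%:Z, 0) :> quad D.
Proof.
elim: k => // k IHk; rewrite -addn1 natrD IHk; congr pair; rewrite /=; lia.
Qed.

Lemma quad_natM (k : nat) (x : quad D) :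
  k%:R * x = (k%:Z * x.1, k%:Z * x.2) :> quad D.
Proof.
by rewrite quad_nat; case: x => x y; rewrite quadM; congr pair; ring.
Qed.

Lemma quad_int_exp (x : int) (k : nat) :
  ((x, 0) : quad D) ^+ k = (x ^+ k, 0).
Proof.
elim: k => // k IHk; rewrite !exprS IHk quadM; congr pair; ring.
Qed.

Lemma quad_sqrt_exp (k : nat) :
  ((0, 1) : quad D) ^+ k.*2.+1 = (0, D ^+ k).
Proof.
rewrite exprS -mul2n exprM.
have -> : ((0, 1) : quad D) ^+ 2 = (D, 0).
  by rewrite expr2 quadM; congr pair; ring.
by rewrite quad_int_exp quadM; congr pair; ring.
Qed.

End QuadraticRing.

Section LucasSequence.

Variable m : int.
Let D := 4 - m.
Let u := lucas_u 4 m.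

(** Half of the companion Lucas number v_k(4, m): 2 + sqrt D and its conjugate are the roots of X^2
    - 4 X + m. *)
Definition lucas_x (k : nat) : int := (((2, 1) : quad D) ^+ k).1.

Lemma lucas_uSS (k : nat) : u k.+2 = 4 * u k.+1 - m * u k.
Proof. by []. Qed.

Lemma lucas_quad (k : nat) : ((2, 1) : quad D) ^+ k = (lucas_x k, u k).
Proof.
rewrite /lucas_x; suff E : (((2, 1) : quad D) ^+ k).2 = u k.
  by rewrite -E; case: (_ ^+ _).
elim/ltn_ind: k => -[|[|k]] IH //.
rewrite lucas_uSS -!IH ?ltnS //; rewrite !exprS.
by case: (_ ^+ _) => x y; rewrite !quadM /D /=; ring.
Qed.

Lemma lucas_xS (k : nat) : lucas_x k.+1 = 2 * lucas_x k + D * u k.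
Proof. by rewrite {1}/lucas_x exprS lucas_quad quadM /=; ring. Qed.

Lemma lucas_uS (k : nat) : u k.+1 = lucas_x k + 2 * u k.
Proof.
have := lucas_quad k.+1; rewrite exprS lucas_quad quadM => -[_ <-]; ring.
Qed.

Lemma lucas_norm (k : nat) : lucas_x k ^+ 2 - D * u k ^+ 2 = m ^+ k.
Proof.
elim: k => [|k IHk]; first by rewrite /lucas_x /u /=; ring.
by rewrite [m ^+ _]exprS -IHk lucas_xS lucas_uS /D; ring.
Qed.

(** For e = -1 the base is the conjugate of 2 + sqrt D, and conjugation negates the second
    coordinate; for e = 0 the base is rational. *)
Lemma lucas_quad_sign (e : int) (k : nat) : `|e| <= 1 ->
  (((2, e) : quad D) ^+ k).2 = e * u k.
Proof.
move=> e1; have [->|->|->] : [\/ e = 0, e = 1 | e = -1].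
- have : -1 <= e <= 1 by lia.
  by move: e {e1} => [[|[|?]]|[|?]] //= _;
     [constructor 1 | constructor 2 | constructor 3].
- by rewrite quad_int_exp mul0r.
- by rewrite lucas_quad mul1r.
suff -> : ((2, -1) : quad D) ^+ k = (lucas_x k, - u k) by rewrite mulN1r.
elim: k => [|k IHk]; first by [].
by rewrite exprS IHk quadM lucas_xS lucas_uS; congr pair; ring.
Qed.

(** Pascal's rule couples [B] with the companion sum [C]. Up to the sign (-1)^k, the Lucas numbers
    of odd index and those of even index, matched with [B] and 4 [C], obey the same coupled
    recurrence. *)
Lemma morgan_voyce_lucas (k : nat) :
  \sum_(i < k.+1) 'C(k + i, i.*2)%:R * (-16) ^+ i * m ^+ (k - i)
    = (-1) ^+ k * u k.*2.+1.
Proof.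
pose B k := \sum_(i < k.+1) 'C(k + i, i.*2)%:R * (-16) ^+ i * m ^+ (k - i).
pose C k := \sum_(i < k.+1)
  'C((k + i).+1, i.*2.+1)%:R * (-16) ^+ i * m ^+ (k - i).
have BS j : B j.+1 = m * B j - 16 * C j.
  (* A vanishing top term is appended, so that this sum has the same index range as [B j.+1]. *)
  have -> : m * B j =
      \sum_(i < j.+2) 'C(j + i, i.*2)%:R * (-16) ^+ i * m ^+ (j.+1 - i).
    rewrite big_ord_recr /= bin_small; last by lia.
    rewrite !mul0r addr0 mulr_sumr; apply: eq_bigr => i _.
    by rewrite subSn ?exprS; [ring | rewrite -ltnS].
  rewrite /B [LHS]big_ord_recl [X in _ = X - _]big_ord_recl /=.
  rewrite !addn0 !bin0 -addrA; congr (_ + _).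
  rewrite -mulNr /C mulr_sumr -big_split /=; apply: eq_bigr => i _.
  rewrite /bump /= !add1n doubleS addSn addnS subSS binS natrD exprS; ring.
have CS j : C j.+1 = B j.+1 + m * C j.
  have -> : m * C j = \sum_(i < j.+2)
      'C((j + i).+1, i.*2.+1)%:R * (-16) ^+ i * m ^+ (j.+1 - i).
    rewrite big_ord_recr /= bin_small; last by lia.
    rewrite !mul0r addr0 mulr_sumr; apply: eq_bigr => i _.
    by rewrite subSn ?exprS; [ring | rewrite -ltnS].
  rewrite -big_split /=; apply: eq_bigr => i _.
  by rewrite addSn binS natrD; ring.
suff [] : B k = (-1) ^+ k * u k.*2.+1 /\ 4 * C k = (-1) ^+ k * u k.*2.+2 by [].
elim: k => [|k [IHB IHC]].
  rewrite /B /C !big_ord1 /= !addn0 bin0 bin1 subnn !expr0 /u /=.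
  by split; ring.
have EB : B k.+1 = (-1) ^+ k.+1 * u k.+1.*2.+1.
  rewrite BS IHB doubleS lucas_uSS exprS.
  have -> : 16 * C k = 4 * (4 * C k) by ring.
  by rewrite IHC; ring.
split=> //; have -> : 4 * C k.+1 = 4 * B k.+1 + m * (4 * C k).
  by rewrite CS; ring.
by rewrite EB IHC doubleS [u _.+4]lucas_uSS exprS; ring.
Qed.

End LucasSequence.

(** * The Lucas sequence modulo p^2 *)

Section LucasModPrime.

Variables (p : nat) (m : int).
Hypotheses (p_pr : prime p) (p_odd : odd p) (p_ndvd_m : ~~ (p%:Z %| m)%Z).
Let D := 4 - m.
Let u := lucas_u 4 m.
Let x := lucas_x m.
Let n := p.-1./2.
Let e := legendre D p.
Let s := legendre (- m) p.
Let p_gt0 := prime_gt0 p_pr.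

(** Modulo p the power splits into 2^p and (sqrt D)^p = D^n sqrt D, which Fermat and Euler reduce to
    2 and e sqrt D. *)
Lemma lucas_frobenius :
  exists z : quad D, ((2, 1) : quad D) ^+ p = (2, e) + p%:R * z.
Proof.
have -> : ((2, 1) : quad D) = (2, 0) + (0, 1) by rewrite quadD addr0 add0r.
have [z ->] := exprD_prime ((2, 0) : quad D) (0, 1) p_pr.
have /dvdz_subP[v vE] := dvdz_fermat p_pr 2.
have /dvdz_subP[w wE] := legendre_euler p_pr p_odd D.
exists (z + (v, w)); rewrite quad_int_exp vE.
rewrite {2}(odd_prime_half p_pr p_odd) quad_sqrt_exp wE.
rewrite mulrDr !quad_natM; case: z => z t.
rewrite !quadD !natz /e /=; congr pair; ring.
Qed.

Lemma lucas_pow_step (a : nat) : (0 < a)%N ->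
  (p%:Z ^+ 2 %| u (p ^ a.+1) - e * u (p ^ a)%N)%Z.
Proof.
move=> a_gt0; have [z zE] := lucas_frobenius.
have [t] := expr_congr_sqr p_gt0 a_gt0 zE.
rewrite -exprM -expnS lucas_quad quad_natM => /(congr1 snd) /=.
rewrite lucas_quad_sign ?legendre_norm // -/u => ->.
by rewrite [_ * u _ + _]addrC addrK -[(p ^ 2)%:Z]natz natrX natz dvdz_mulr.
Qed.

Lemma lucas_xu_prime :
  (p%:Z %| x p - 2)%Z /\ (p%:Z %| u p - e)%Z.
Proof.
have [[v w]] := lucas_frobenius; rewrite lucas_quad quad_natM quadD /=.
by case=> xE uE; split; apply/dvdz_subP; [exists v | exists w]; rewrite natz.
Qed.

(** The norm equation yields only the square of the rational coordinate; knowing that coordinate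
    modulo p then selects the root modulo p^2. *)
Lemma sqr_congr_lift (y z : int) :
  (p%:Z ^+ 2 %| y ^+ 2 - z ^+ 2)%Z -> ~~ (p%:Z %| y + z)%Z ->
  (p%:Z ^+ 2 %| y - z)%Z.
Proof.
move=> yz npyz; rewrite -(@Gauss_dvdzl _ _ (y + z)) ?subr_sqr //.
  by rewrite -subr_sqr.
by rewrite coprimezE abszX coprimeXl // prime_coprime //.
Qed.

Lemma odd_prime_ndvd2 : ~~ (p%:Z %| 2)%Z.
Proof.
by rewrite dvdzE /= gtnNdvd // odd_prime_ge3.
Qed.

Lemma legendre_sqr_negm : s * s = 1.
Proof.
rewrite /s; case: (legendre_values p (- m)) => -[+ ->] //.
by rewrite dvdzE abszN -dvdzE (negPf p_ndvd_m).
Qed.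

Lemma legendre_euler_negm : (p%:Z %| s * (- m) ^+ n - 1)%Z.
Proof.
have /dvdzP[v vE] := legendre_euler p_pr p_odd (- m).
apply/dvdzP; exists (s * v); rewrite -mulrA -vE mulrBr -/s.
by rewrite legendre_sqr_negm.
Qed.

(** As p divides u_(p-1), the norm equation gives x_(p-1)^2 = m^(p-1) = (s (- m)^n)^2 modulo p^2.
    Both x_(p-1) and s (- m)^n are 1 modulo p, so they agree modulo p^2, and u_p = x_(p-1) + 2
    u_(p-1). *)
Lemma lucas_prime_split : e = 1 ->
  (p%:Z %| u p.-1)%Z /\
  (p%:Z ^+ 2 %| u p - (2 * u p.-1 + s * (- m) ^+ n))%Z.
Proof.
move=> e1; have [/dvdzP[v vE] /dvdzP[w wE]] := lucas_xu_prime.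
have pE : p = p.-1.+1 by rewrite prednK.
have xS : x p = 2 * x p.-1 + D * u p.-1 by rewrite {1}pE /x lucas_xS.
have uS : u p = x p.-1 + 2 * u p.-1 by rewrite {1}pE /u lucas_uS.
have pu : (p%:Z %| u p.-1)%Z.
  (* Eliminating x_(p-1) gives m u_(p-1) = 2 u_p - x_p, which is 2 e - 2 = 0 modulo p. *)
  have : (p%:Z %| m * u p.-1)%Z.
    apply/dvdzP; exists (2 * w - v); rewrite mulrBl -mulrA -wE -vE e1 xS uS /D.
    ring.
  by rewrite prime_dvdzM // (negPf p_ndvd_m).
split=> //; case/dvdzP: (pu) => t tE.
have -> : u p - (2 * u p.-1 + s * (- m) ^+ n) = x p.-1 - s * (- m) ^+ n.
  by rewrite uS; ring.
have /dvdzP[r rE] := legendre_euler_negm.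
have x1 : x p.-1 = 1 + (w - 2 * t) * p%:Z.
  by rewrite mulrBl -wE -mulrA -tE uS e1; ring.
apply: sqr_congr_lift.
  have -> : x p.-1 ^+ 2 - (s * (- m) ^+ n) ^+ 2 = D * u p.-1 ^+ 2.
    have := lucas_norm m p.-1; rewrite -/x -/u -/D => E.
    rewrite -[x _ ^+ 2](subrK (D * u p.-1 ^+ 2)) E.
    rewrite [(s * _) ^+ 2]exprMn [s ^+ 2]expr2 legendre_sqr_negm mul1r -exprM.
    rewrite mulnC exprM sqrrN.
    rewrite -exprM; have -> : (2 * n = p.-1)%N.
      by rewrite [in RHS](odd_prime_half p_pr p_odd) mul2n.
    ring.
  by rewrite tE exprMn mulrA dvdz_mull.
have -> : x p.-1 + s * (- m) ^+ n = 2 + (w - 2 * t + r) * p%:Z.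
  rewrite mulrDl -rE x1; ring.
by rewrite rpredDr ?odd_prime_ndvd2 // dvdz_mull.
Qed.

(** The same argument at p + 1: x_(p+1) and m s (- m)^n are both m modulo p and have congruent
    squares modulo p^2. The factor m comes from m u_p = 2 u_(p+1) - x_(p+1) and keeps the congruence
    in the integers. *)
Lemma lucas_prime_inert : e = -1 ->
  (p%:Z %| u p.+1)%Z /\
  (p%:Z ^+ 2 %| m * u p - (2 * u p.+1 - m * (s * (- m) ^+ n)))%Z.
Proof.
move=> e1; have [/dvdzP[v vE] /dvdzP[w wE]] := lucas_xu_prime.
have xS : x p.+1 = 2 * x p + D * u p by rewrite /x lucas_xS.
have uS : u p.+1 = x p + 2 * u p by rewrite /u lucas_uS.
have uE : u p.+1 = (2 * w + v) * p%:Z.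
  by rewrite mulrDl -mulrA -wE -vE e1 uS; ring.
split; first by rewrite uE dvdz_mull.
have -> : m * u p - (2 * u p.+1 - m * (s * (- m) ^+ n)) =
  - (x p.+1 - m * (s * (- m) ^+ n)) by rewrite uS xS /D; ring.
rewrite rpredN.
have /dvdzP[r rE] := legendre_euler_negm.
have xE : x p.+1 = m + (2 * v + D * w) * p%:Z.
  by rewrite mulrDl -!mulrA -wE -vE e1 xS /D; ring.
apply: sqr_congr_lift.
  have -> : x p.+1 ^+ 2 - (m * (s * (- m) ^+ n)) ^+ 2 = D * u p.+1 ^+ 2.
    have := lucas_norm m p.+1; rewrite -/x -/u -/D => E.
    rewrite -[x _ ^+ 2](subrK (D * u p.+1 ^+ 2)) E.
    rewrite !exprMn [s ^+ 2]expr2 legendre_sqr_negm mul1r -exprM mulnC exprM.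
    rewrite sqrrN -exprM -exprD; have -> : (2 + 2 * n = p.+1)%N.
      by rewrite [in RHS](odd_prime_half p_pr p_odd) mul2n.
    ring.
  by rewrite uE exprMn mulrA dvdz_mull.
have -> : x p.+1 + m * (s * (- m) ^+ n)
    = 2 * m + (2 * v + D * w + m * r) * p%:Z.
  have -> : s * (- m) ^+ n = 1 + r * p%:Z by rewrite -rE; ring.
  by rewrite xE; ring.
have np2m : ~~ (p%:Z %| 2 * m)%Z.
  by rewrite prime_dvdzM // negb_or odd_prime_ndvd2.
by rewrite rpredDr // dvdz_mull.
Qed.

End LucasModPrime.

(** * Rationals with denominator prime to p *)

Lemma mul_denq (x : rat) : x * (denq x)%:~R = (numq x)%:~R.
Proof. by rewrite -[x in x * _]divq_num_den divfK // intr_eq0 denq_neq0. Qed.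

Section LocalizationAtPrime.

Variable p : nat.
Hypothesis p_pr : prime p.

(** The fraction c / d need not be in lowest terms, which makes the closure properties below
    immediate. *)
Lemma p_integral_frac (x : rat) (c d : int) :
  ~~ (p%:Z %| d)%Z -> x * d%:~R = c%:~R -> p_integral p x.
Proof.
move=> pd xE; have xdE : numq x * d = c * denq x.
  by apply/(@intr_inj rat); rewrite !rmorphM /= -xE -mul_denq mulrAC.
have : (denq x %| numq x * d)%Z by rewrite xdE dvdz_mull.
rewrite Gauss_dvdzr; last by rewrite coprimezE coprime_sym coprime_num_den.
rewrite dvdzE => den_d; apply: coprime_dvdr den_d _.
by rewrite prime_coprime.
Qed.

Lemma p_integral_den (x : rat) : p_integral p x -> ~~ (p%:Z %| denq x)%Z.
Proof. by rewrite /p_integral prime_coprime // dvdzE. Qed.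

Lemma p_integral_int (c : int) : p_integral p c%:~R.
Proof.
apply: (@p_integral_frac _ c 1); last by rewrite mulr1.
by rewrite dvdzE /= gtnNdvd // prime_gt1.
Qed.

Lemma p_integral_nat (k : nat) : p_integral p k%:R.
Proof. exact: p_integral_int k%:Z. Qed.

Lemma p_integral_inv (c : int) : ~~ (p%:Z %| c)%Z -> p_integral p c%:~R^-1.
Proof.
move=> pc; apply: (@p_integral_frac _ 1 c) => //.
by rewrite mulVf // intr_eq0; apply: contraNneq pc => ->; rewrite dvdz0.
Qed.

Lemma ndvdzM (c d : int) :
  ~~ (p%:Z %| c)%Z -> ~~ (p%:Z %| d)%Z -> ~~ (p%:Z %| c * d)%Z.
Proof. by rewrite prime_dvdzM // negb_or => -> ->. Qed.

Lemma p_integralD (x y : rat) :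
  p_integral p x -> p_integral p y -> p_integral p (x + y).
Proof.
move=> /p_integral_den px /p_integral_den py.
apply: (@p_integral_frac _ (numq x * denq y + numq y * denq x)
  (denq x * denq y)); first exact: ndvdzM.
by rewrite rmorphD !rmorphM /= -!mul_denq; ring.
Qed.

Lemma p_integralM (x y : rat) :
  p_integral p x -> p_integral p y -> p_integral p (x * y).
Proof.
move=> /p_integral_den px /p_integral_den py.
apply: (@p_integral_frac _ (numq x * numq y) (denq x * denq y)).
  exact: ndvdzM.
by rewrite !rmorphM /= -!mul_denq; ring.
Qed.

Lemma p_integralN (x : rat) : p_integral p x -> p_integral p (- x).
Proof. by move=> px; rewrite -mulN1r p_integralM // (p_integral_int (-1)). Qed.

Lemma p_integralX (x : rat) (k : nat) :
  p_integral p x -> p_integral p (x ^+ k).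
Proof.
move=> px; elim: k => [|k IHk]; first exact: p_integral_nat 1.
by rewrite exprS p_integralM.
Qed.

(** From d < p^a, the p-adic valuation of d is at most a - 1. *)
Lemma p_integral_pow_quot (a d : nat) : (0 < d < p ^ a)%N ->
  p_integral p ((p ^ a.-1)%:R / d%:R).
Proof.
case/andP=> d_gt0 d_lt; have [d' cop dE] := pfactor_coprime p_pr d_gt0.
have v_lt : (logn p d < a)%N.
  rewrite -(ltn_exp2l _ _ (prime_gt1 p_pr)); apply: leq_ltn_trans d_lt.
  by rewrite dvdn_leq // pfactor_dvdnn.
apply: (@p_integral_frac _ (p ^ (a.-1 - logn p d))%:Z d'%:Z).
  by rewrite dvdzE /= -prime_coprime.
have d0 : d%:R != 0 :> rat by rewrite pnatr_eq0 -lt0n.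
apply: (mulIf d0); rewrite mulrAC divfK // -!pmulrn -!natrM; congr _%:R.
rewrite {2}dE mulnCA -expnD subnK 1?mulnC //; lia.
Qed.

(** Integrality of the two sides is left out here, so that congruences compose freely;
    [rat_congr_p2] restores it at the end from the right-hand side alone. *)
Definition congr_p2 (x y : rat) : Prop :=
  exists2 z, p_integral p z & x - y = (p ^ 2)%:R * z.

Lemma congr_p2_refl (x : rat) : congr_p2 x x.
Proof. by exists 0; [exact: p_integral_nat 0 | rewrite subrr mulr0]. Qed.

Lemma congr_p2_sym (x y : rat) : congr_p2 x y -> congr_p2 y x.
Proof.
case=> z pz zE; exists (- z); first exact: p_integralN.
by rewrite mulrN -zE opprB.
Qed.

Lemma congr_p2D (x y z t : rat) :
  congr_p2 x y -> congr_p2 z t -> congr_p2 (x + z) (y + t).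
Proof.
move=> [v pv vE] [w pw wE]; exists (v + w); first exact: p_integralD.
by rewrite mulrDr -vE -wE; ring.
Qed.

Lemma congr_p2_trans (y x z : rat) :
  congr_p2 x y -> congr_p2 y z -> congr_p2 x z.
Proof.
move=> [v pv vE] [w pw wE]; exists (v + w); first exact: p_integralD.
by rewrite mulrDr -vE -wE; ring.
Qed.

Lemma congr_p2Ml (x y z : rat) :
  p_integral p z -> congr_p2 x y -> congr_p2 (z * x) (z * y).
Proof.
move=> pz [v pv vE]; exists (z * v); first exact: p_integralM.
by rewrite mulrCA -vE; ring.
Qed.

Lemma congr_p2_int (c d : int) :
  (p%:Z ^+ 2 %| c - d)%Z -> congr_p2 c%:~R d%:~R.
Proof.
case/dvdzP=> v vE; exists v%:~R; first exact: p_integral_int.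
by rewrite -rmorphB /= vE rmorphM rmorphXn /= natrX mulrC.
Qed.

Lemma congr_p2_sum (N : nat) (F G : nat -> rat) :
  (forall k, (k < N)%N -> congr_p2 (F k) (G k)) ->
  congr_p2 (\sum_(0 <= k < N) F k) (\sum_(0 <= k < N) G k).
Proof.
elim: N => [|N IHN] FG; first by rewrite !big_geq //; exact: congr_p2_refl.
rewrite !big_nat_recr //=; apply: congr_p2D; last exact: FG.
by apply: IHN => k kN; apply: FG; apply: ltnW.
Qed.

Lemma rat_congr_p2 (x y : rat) :
  p_integral p y -> congr_p2 x y -> rat_congr p (p ^ 2) x y.
Proof.
move=> py [z pz zE]; split=> //; last by exists z.
rewrite -[x](subrK y) zE p_integralD ?p_integralM //; exact: p_integral_nat.
Qed.

End LocalizationAtPrime.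

(** * Central binomial coefficients modulo p^2 *)

Lemma central_bin_rec (k : nat) :
  (k.+1 * 'C(k.+1.*2, k.+1) = 2 * k.*2.+1 * 'C(k.*2, k))%N.
Proof.
have e1 := mul_bin_diag k.*2.+2 k; have e2 := mul_bin_diag k.*2.+1 k.
have e3 : 'C(k.*2.+1, k) = 'C(k.*2.+1, k.+1).
  by rewrite -[in RHS]bin_sub; [congr 'C(_, _) | ]; lia.
rewrite /= in e1 e2; rewrite doubleS -e1 e3.
have -> : (k.*2.+2 = 2 * k.+1)%N by lia.
by rewrite -!mulnA -e2.
Qed.

Lemma bin_double_rec (N k : nat) : (k <= N)%N ->
  ((k.*2.+1 * k.*2.+2) * 'C(N + k.+1, k.+1.*2)
    = (N + k).+1 * (N - k) * 'C(N + k, k.*2))%N.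
Proof.
move=> kN; have e1 := mul_bin_diag (N + k).+1 k.*2.+1.
have e2 := mul_bin_left (N + k) k.*2.
rewrite /= in e1; rewrite addnS doubleS -mulnA -e1 mulnCA e2 mulnA.
by congr (_ * _ * _)%N; lia.
Qed.

Lemma central_bin_congr (p a N k : nat) : prime p -> (0 < a)%N ->
  (p ^ a = N.*2.+1)%N -> (k <= N)%N ->
  congr_p2 p 'C(k.*2, k)%:R ((-16) ^+ k * 'C(N + k, k.*2)%:R).
Proof.
move=> p_pr a_gt0 qE kN.
(* The error is kept as a multiple of the central binomial itself: the recurrence divides by k + 1,
   which p may divide. *)
suff [r pr rE] : exists2 r, p_integral p r &
    (-16) ^+ k * 'C(N + k, k.*2)%:R = 'C(k.*2, k)%:R * (1 + (p ^ 2)%:R * r).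
  apply: congr_p2_sym => //.
  exists ('C(k.*2, k)%:R * r); last by rewrite rE; ring.
  by apply: p_integralM pr => //; apply: p_integral_nat.
elim: k kN => [|k IHk] kN.
  exists 0; first exact: (p_integral_nat p_pr 0).
  by rewrite addn0 !bin0 expr0; ring.
have [r pr rE] := IHk (ltnW kN).
(* Since 2k + 1 < p^a, [t] is p-integral even when p divides 2k + 1. The new factor is 1 - p^2 t^2,
   and expanding its product with 1 + p^2 r gives the next witness. *)
pose t : rat := (p ^ a.-1)%:R / k.*2.+1%:R.
have pt : p_integral p t by apply: p_integral_pow_quot => //; lia.
have pp2 := p_integral_nat p_pr (p ^ 2).
exists (r + - (t ^+ 2 * (1 + (p ^ 2)%:R * r))).
  apply: p_integralD => //; apply: p_integralN => //.
  apply: p_integralM => //; first exact: p_integralX.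
  by apply: p_integralD; [|exact: (p_integral_nat p_pr 1)|exact: p_integralM].
have tE : (p ^ 2)%:R * t ^+ 2 = (N.*2.+1)%:R ^+ 2 / k.*2.+1%:R ^+ 2.
  rewrite /t -qE -[in RHS](prednK a_gt0) [in RHS]expnS natrM natrX.
  by rewrite !exprMn exprVn; ring.
have -> : 1 + (p ^ 2)%:R * (r + - (t ^+ 2 * (1 + (p ^ 2)%:R * r)))
  = (1 - (p ^ 2)%:R * t ^+ 2) * (1 + (p ^ 2)%:R * r) by ring.
have /(congr1 (fun i : nat => i%:R : rat)) bE := central_bin_rec k.
have /(congr1 (fun i : nat => i%:R : rat)) cE := bin_double_rec (ltnW kN).
rewrite !natrM in bE; rewrite !natrM natrB 1?ltnW // in cE.
have k1 : k.+1%:R != 0 :> rat by rewrite pnatr_eq0.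
have k2 : k.*2.+1%:R != 0 :> rat by rewrite pnatr_eq0.
have k3 : k.*2.+2%:R != 0 :> rat by rewrite pnatr_eq0.
have {}cE : 'C(N + k.+1, k.+1.*2)%:R = (N + k).+1%:R * (N%:R - k%:R)
    * 'C(N + k, k.*2)%:R / (k.*2.+1%:R * k.*2.+2%:R) :> rat.
  by rewrite -cE mulrC mulKf // mulf_neq0.
have {}bE : 'C(k.+1.*2, k.+1)%:R = 2 * k.*2.+1%:R * 'C(k.*2, k)%:R / k.+1%:R
    :> rat by rewrite -bE mulrC mulKf.
rewrite cE bE tE exprS.
transitivity (-16 * (N + k).+1%:R * (N%:R - k%:R)
   / (k.*2.+1%:R * k.*2.+2%:R) * ((-16) ^+ k * 'C(N + k, k.*2)%:R) : rat).
  by ring.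
rewrite rE mulrA [RHS]mulrA; congr (_ * _).
have dE i : i.*2%:R = 2 * i%:R :> rat by rewrite -mul2n natrM.
have sE i : i.+1%:R = i%:R + 1 :> rat by rewrite -addn1 natrD.
move: k1 k2 k3; rewrite !sE !dE natrD => k1 k2 k3.
by field; rewrite k1 k2 k3.
Qed.

(** * The main congruences *)

(** As C(2N+2, N+1) = 2 C(2N+1, N+1), the share -m/2 of the new central binomial term cancels the
    previous remainder C(2N+1, N+1) / m^N. *)
Lemma catalan_sum (m : rat) (N : nat) : m != 0 ->
  \sum_(0 <= k < N.+1) catalan k / m ^+ k
    = (4 - m) / 2 * (\sum_(0 <= k < N.+1) 'C(k.*2, k)%:R / m ^+ k) + m / 2
      - 'C(N.*2.+1, N.+1)%:R / m ^+ N.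
Proof.
move=> m0; have m0X k : m ^+ k != 0 by rewrite expf_neq0.
have catE k : catalan k = 2 * 'C(k.*2, k)%:R - 'C(k.*2.+1, k.+1)%:R.
  have /(congr1 (fun i : nat => i%:R : rat)) := mul_bin_diag k.*2.+1 k.
  rewrite !natrM /= => E; have k0 : k.+1%:R != 0 :> rat by rewrite pnatr_eq0.
  have -> : 'C(k.*2.+1, k.+1)%:R
      = k.*2.+1%:R * 'C(k.*2, k)%:R / k.+1%:R :> rat.
    by rewrite E mulrC mulKf.
  move: k0; rewrite /catalan -[k.*2.+1]addn1 -[k.+1]addn1 !natrD -mul2n natrM.
  by move=> k0; field.
elim: N => [|N IHN].
  by rewrite !big_nat1 catE !expr0 !bin0 binn; field.
have bE : 'C(N.+1.*2, N.+1) = (2 * 'C(N.*2.+1, N.+1))%N.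
  have e3 : 'C(N.*2.+1, N) = 'C(N.*2.+1, N.+1).
    by rewrite -[in RHS]bin_sub; [congr 'C(_, _) | ]; lia.
  by rewrite doubleS binS e3 mul2n addnn.
rewrite big_nat_recr //= IHN [in RHS]big_nat_recr //= catE bE natrM exprS.
by field; rewrite m0 m0X.
Qed.

(** Neighbouring entries of row p - 1 add up to an inner entry of row p, a multiple of p, so they
    are opposite modulo p. *)
Lemma bin_pred_prime (p k : nat) : prime p -> (k < p)%N ->
  (p%:Z %| 'C(p.-1, k)%:Z - (-1) ^+ k)%Z.
Proof.
move=> p_pr; have p_gt0 := prime_gt0 p_pr.
elim: k => [|k IHk] kp; first by rewrite bin0 subrr dvdz0.
have -> : 'C(p.-1, k.+1)%:Z - (-1) ^+ k.+1
    = 'C(p, k.+1)%:Z - ('C(p.-1, k)%:Z - (-1) ^+ k).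
  by rewrite -[in 'C(p, _)](prednK p_gt0) binS PoszD exprS; ring.
apply: rpredB; last exact: IHk (ltnW kp).
by rewrite dvdzE /= prime_dvd_bin.
Qed.

Section MainCongruence.

Variables (p : nat) (m : int).
Hypotheses (p_pr : prime p) (p_odd : odd p) (p_ndvd_m : ~~ (p%:Z %| m)%Z).
Let e := legendre (4 - m) p.
Let s := legendre (- m) p.
Let chi := legendre (m * (m - 4)) p.
Let u := lucas_u 4 m.
Let n := p.-1./2.
Let w : rat := mbar p m * (u `|(p%:Z - e)%R|%N)%:~R.

Let m_neq0 : m%:~R != 0 :> rat.
Proof.
by rewrite intr_eq0; apply: contraNneq p_ndvd_m => ->; rewrite dvdz0.
Qed.

Let p_ndvd_Nm : ~~ (p%:Z %| - m)%Z.
Proof. by rewrite rpredN. Qed.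

Lemma legendre_disc : chi = s * e.
Proof.
rewrite /chi -[m * _]opprK -mulrN opprB.
by rewrite -mulNr legendreM.
Qed.

Lemma p_integral_mbar : p_integral p (mbar p m).
Proof.
rewrite /mbar; case: ifP => _; first exact: (p_integral_nat p_pr 1).
case: ifP => _; first exact: (p_integral_nat p_pr 2).
apply: p_integralM => //; first exact: (p_integral_nat p_pr 2).
exact: p_integral_inv.
Qed.

Lemma mbar_legendre :
  mbar p m = if e == 0 then 1 else if e == 1 then 2 else 2 / m%:~R.
Proof.
rewrite /mbar jacobi_prime // -/e eqz_mod_dvd -(opprB 4 m) rpredN /e.
by case: (legendre_values p (4 - m)) => -[H ->]; rewrite ?H ?(negPf H).
Qed.

Lemma dvdz_sqrM (x y : int) :
  (p%:Z %| x)%Z -> (p%:Z %| y)%Z -> (p%:Z ^+ 2 %| x * y)%Z.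
Proof. by move=> px py; rewrite expr2 dvdz_mul. Qed.

(** For each value of e, p divides u_(p-e). Since s (- m)^n is 1 modulo p, replacing it by 1 in
    front of u_(p-e) changes the value by a multiple of p^2 only. *)
Lemma lucas_prime_congr :
  congr_p2 p (u p)%:~R ((- m%:~R) ^+ n * (chi%:~R + s%:~R * w)).
Proof.
have ps : (p%:Z %| 1 - s * (- m) ^+ n)%Z.
  by rewrite -opprB rpredN legendre_euler_negm.
have intN : (- m%:~R) ^+ n = ((- m) ^+ n)%:~R :> rat.
  by rewrite rmorphXn rmorphN.
rewrite /w mbar_legendre legendre_disc.
case: (legendre_values p (4 - m)) => -[_]; rewrite -/e => eE; rewrite eE /=.
- rewrite addn0 mulr0 rmorph0 add0r mul1r intN -!rmorphM /=.
  apply: congr_p2_int => //.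
  have [_] := lucas_xu_prime m p_pr p_odd; rewrite -/e -/u eE subr0 => pu.
  have -> : u p - (- m) ^+ n * (s * u p) = u p * (1 - s * (- m) ^+ n) by ring.
  exact: dvdz_sqrM.
- have -> : `|(p%:Z - 1)%R|%N = p.-1 by lia.
  rewrite mulr1 intN -[2]/(2%:~R) -!rmorphM -rmorphD -rmorphM /=.
  apply: congr_p2_int => //.
  have [] := lucas_prime_split p_pr p_odd p_ndvd_m eE.
  rewrite -/u -/s -/n => pu pE.
  have -> : u p - (- m) ^+ n * (s + s * (2 * u p.-1)) =
    (u p - (2 * u p.-1 + s * (- m) ^+ n))
    + (2 * u p.-1) * (1 - s * (- m) ^+ n) by ring.
  by apply: rpredD => //; apply: dvdz_sqrM => //; apply: dvdz_mull.
rewrite addn1.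
have [] := lucas_prime_inert p_pr p_odd p_ndvd_m eE.
rewrite -/u -/s -/n => pu pE.
have -> : (u p)%:~R = m%:~R^-1 * (m * u p)%:~R :> rat.
  by rewrite rmorphM mulKf.
have -> : (- m%:~R) ^+ n * ((s * -1)%:~R + s%:~R * (2 / m%:~R * (u p.+1)%:~R))
   = m%:~R^-1 * ((- m) ^+ n * (m * - s + s * (2 * u p.+1)))%:~R :> rat.
  by rewrite intN !(rmorphM, rmorphD, rmorphN) /=; field.
apply: congr_p2Ml => //; first exact: p_integral_inv.
apply: congr_p2_int => //.
have -> : m * u p - (- m) ^+ n * (m * - s + s * (2 * u p.+1)) =
    (m * u p - (2 * u p.+1 - m * (s * (- m) ^+ n)))
    + (2 * u p.+1) * (1 - s * (- m) ^+ n) by ring.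
by apply: rpredD => //; apply: dvdz_sqrM => //; apply: dvdz_mull.
Qed.

(** Splits off the power (- m)^(n p^(b+1)), which is s modulo p^2 by [legendre_pow_sqr]. *)
Lemma half_prime_powS (b : nat) :
  ((p ^ b.+2).-1./2 = (p ^ b.+1).-1./2 + n * p ^ b.+1)%N.
Proof.
have := odd_prime_half p_pr p_odd; rewrite -/n => pE.
have : odd (p ^ b.+1) by rewrite oddX p_odd orbT.
rewrite (expnS p b.+1); move: (p ^ b.+1)%N => q q_odd.
have qE : q = q.-1./2.*2.+1 by lia.
move: (q.-1./2) qE => h ->; rewrite pE.
have -> : (n.*2.+1 * h.*2.+1 = (h + n * h.*2.+1).*2.+1)%N.
  by rewrite -!mul2n; ring.
by lia.
Qed.

Lemma p_integral_mbar_lucas : p_integral p w.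
Proof.
by apply: p_integralM => //; [exact: p_integral_mbar | exact: p_integral_int].
Qed.

Lemma p_integral_lucas_rhs : p_integral p (chi%:~R + s%:~R * w).
Proof.
apply: p_integralD => //; first exact: p_integral_int.
apply: p_integralM => //; first exact: p_integral_int.
exact: p_integral_mbar_lucas.
Qed.

Lemma lucas_prime_pow_congr (b : nat) :
  congr_p2 p (u (p ^ b.+1)%N)%:~R
    ((- m%:~R) ^+ (p ^ b.+1).-1./2 * (chi%:~R ^+ b * (chi%:~R + s%:~R * w))).
Proof.
elim: b => [|b IHb].
  by rewrite expn1 expr0 mul1r; apply: lucas_prime_congr.
have := lucas_pow_step m p_pr p_odd (ltn0Sn b); rewrite -/u -/e => step.
apply: (congr_p2_trans p_pr (congr_p2_int p_pr step)).
have := congr_p2Ml p_pr (p_integral_int p_pr e) IHb; rewrite -rmorphM.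
move=> /(congr_p2_trans p_pr); apply.
rewrite half_prime_powS exprD.
set M := (- m%:~R) ^+ _; set R := _ + _.
have := legendre_pow_sqr p_pr p_odd (- m) (ltn0Sn b); rewrite -/s -/n => sE.
have pMR : p_integral p (M * chi%:~R ^+ b * R * chi%:~R).
  apply: p_integralM => //; last exact: p_integral_int.
  apply: p_integralM => //; last exact: p_integral_lucas_rhs.
  apply: p_integralM => //; apply: p_integralX => //.
    by apply: p_integralN => //; apply: p_integral_int.
  exact: p_integral_int.
have := congr_p2Ml p_pr pMR (congr_p2_sym p_pr (congr_p2_int p_pr sE)).
congr congr_p2; last by rewrite rmorphXn rmorphN exprS /=; ring.
(* The Lucas number gained the factor e, and the power of - m gained s; these balance with the new
   factor chi because e = chi s, by s^2 = 1. *)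
have ss := legendre_sqr_negm p_ndvd_m; rewrite -/s in ss.
have <- : chi%:~R * s%:~R = e%:~R :> rat.
  by rewrite -rmorphM legendre_disc mulrAC ss mul1r.
by ring.
Qed.

Lemma central_bin_sum_lucas (a N : nat) : (0 < a)%N ->
  (p ^ a = N.*2.+1)%N ->
  congr_p2 p (\sum_(0 <= k < N.+1) 'C(k.*2, k)%:R / m%:~R ^+ k)
    ((u (p ^ a)%N)%:~R / (- m%:~R) ^+ N).
Proof.
move=> a_gt0 qE.
have -> : (u (p ^ a)%N)%:~R / (- m%:~R) ^+ N = \sum_(0 <= k < N.+1)
    (m%:~R ^+ k)^-1 * ((-16) ^+ k * 'C(N + k, k.*2)%:R) :> rat.
  have -> : (u (p ^ a)%N)%:~R / (- m%:~R) ^+ N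
      = ((-1) ^+ N * u N.*2.+1)%:~R / m%:~R ^+ N :> rat.
    rewrite qE rmorphM rmorphXn /= rmorphN1 [(- _) ^+ N]exprNn invfM.
    by rewrite -exprVn invrN1; ring.
  rewrite -morgan_voyce_lucas rmorph_sum /= mulr_suml big_mkord.
  apply: eq_bigr => i _; rewrite !(rmorphM, rmorphXn) /=.
  have iN : (i <= N)%N by rewrite -ltnS.
  rewrite -[X in _ / _ ^+ X](subnK iN) exprD rmorph_nat rmorphN rmorph_nat.
  by field; rewrite !expf_neq0.
apply: congr_p2_sum => // k kN; rewrite mulrC.
apply: congr_p2Ml => //; last exact: (central_bin_congr p_pr a_gt0 qE).
by rewrite -exprVn; apply: p_integralX => //; apply: p_integral_inv.
Qed.

Lemma central_bin_sum_congr (b N : nat) : (p ^ b.+1 = N.*2.+1)%N ->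
  congr_p2 p (\sum_(0 <= k < N.+1) 'C(k.*2, k)%:R / m%:~R ^+ k)
    (chi%:~R ^+ b * (chi%:~R + s%:~R * w)).
Proof.
move=> qE; apply: (congr_p2_trans p_pr (central_bin_sum_lucas (ltn0Sn b) qE)).
have pmN : p_integral p ((- m%:~R) ^+ N)^-1.
  rewrite -exprVn; apply: p_integralX => //.
  by rewrite -rmorphN; apply: p_integral_inv.
have := congr_p2Ml p_pr pmN (lucas_prime_pow_congr b).
congr congr_p2; first by rewrite mulrC.
have -> : (p ^ b.+1).-1./2 = N by rewrite qE; lia.
by rewrite mulKf // expf_neq0 // oppr_eq0.
Qed.

(** Write c for the binomial coefficient and a = b + 1. Then (p^a + 1) c = 2 p^a C(2N, N), so p^a
    divides c, and c vanishes modulo p^2 if a > 1. If a = 1, then C(2N, N) = C(p - 1, N) is (-1)^N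
    modulo p, which Euler's criterion turns into s m^N. *)
Lemma bin_prime_pow_half_congr (b N : nat) : (p ^ b.+1 = N.*2.+1)%N ->
  congr_p2 p ('C(N.*2.+1, N.+1)%:R / m%:~R ^+ N)
    (2 * p%:R * (b.+1 == 1%N)%:R * s%:~R).
Proof.
move=> qE; have binE : (N.*2.+2 * 'C(N.*2.+1, N.+1)
    = 2 * p ^ b.+1 * 'C(N.*2, N))%N.
  have := mul_bin_diag N.*2.+1 N; rewrite /= qE => E.
  by rewrite -mulnA E; lia.
have pmN : p_integral p (m%:~R ^+ N)^-1.
  by rewrite -exprVn; apply: p_integralX => //; apply: p_integral_inv.
have -> : 2 * p%:R * (b.+1 == 1)%N%:R * s%:~R = (m%:~R ^+ N)^-1
     * (2 * p%:Z * (b.+1 == 1)%N%:Z * s * m ^+ N)%:~R :> rat.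
  rewrite !rmorphM rmorphXn /= -!pmulrn; field.
  by rewrite expf_neq0.
rewrite mulrC; apply: congr_p2Ml => //.
rewrite [_%:R]pmulrn; apply: congr_p2_int => //.
have {binE} : (N.*2.+2%:Z * 'C(N.*2.+1, N.+1)%:Z
   = 2 * p%:Z ^+ b.+1 * 'C(N.*2, N)%:Z).
  rewrite -PoszM binE !PoszM; congr (_ * _ * _).
  by rewrite -[LHS]natz natrX natz.
have -> : N.*2.+2%:Z = p%:Z ^+ b.+1 + 1.
  by rewrite -[p%:Z]natz -natrX qE natz -addn1 PoszD.
set c := 'C(N.*2.+1, N.+1)%:Z => cE.
(* Solving for c in this implicit form avoids inverting p^a + 1; for a = 1 the c on the right only
   contributes a multiple of p^2. *)
have {}cE : c = p%:Z ^+ b.+1 * (2 * 'C(N.*2, N)%:Z - c).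
  by rewrite mulrBr mulrA [_ * 2]mulrC -cE; ring.
case: b qE cE => [|b] qE cE; last first.
  rewrite /= !(mulr0, mul0r) subr0 cE [_ ^+ b.+2]exprS.
  rewrite [_ ^+ b.+1]exprS mulrA -expr2 -mulrA.
  exact: dvdz_mulr.
rewrite eqxx mulr1; rewrite expr1 in cE; rewrite expn1 in qE.
have NE : N = n by rewrite /n qE; lia.
have pc : (p%:Z %| c)%Z by rewrite cE dvdz_mulr.
have /dvdzP[v vE] : (p%:Z %| 'C(N.*2, N)%:Z - (-1) ^+ N)%Z.
  have <- : p.-1 = N.*2 by rewrite qE.
  by apply: bin_pred_prime => //; lia.
have /dvdzP[t tE] := legendre_euler_negm p_pr p_odd p_ndvd_m.
rewrite -/s -/n -NE exprNn in tE.
have sgn2 : (-1) ^+ N * (-1) ^+ N = 1 :> int.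
  by rewrite -expr2 -exprM mulnC exprM sqrrN !expr1n.
have -> : c - 2 * p%:Z * s * m ^+ N =
   p%:Z * (2 * ('C(N.*2, N)%:Z - (-1) ^+ N)
      - 2 * ((-1) ^+ N * (s * ((-1) ^+ N * m ^+ N) - 1)) - c).
  rewrite {1}cE.
  have -> : (-1) ^+ N * (s * ((-1) ^+ N * m ^+ N) - 1)
     = s * m ^+ N * ((-1) ^+ N * (-1) ^+ N) - (-1) ^+ N by ring.
  by rewrite sgn2; ring.
apply: dvdz_sqrM => //.
apply: rpredB => //; rewrite vE tE.
by apply: rpredB; do !apply: dvdz_mull.
Qed.

End MainCongruence.

Theorem theorem1p2 (p a : nat) (m : int)
    (p_prime : prime p) (p_odd : odd p) (a_gt0 : (0 < a)%N)
    (p_ndvd_m : ~~ (p%:Z %| m)%Z) :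
  rat_congr p (p ^ 2)
    (\sum_(0 <= k < ((p ^ a - 1) %/ 2).+1) 'C(k.*2, k)%:R / m%:~R ^+ k)
    ((jacobi (m * (m - 4)) (p ^ a))%:~R
     + (jacobi (- m) p)%:~R * (jacobi (m * (m - 4)) (p ^ (a - 1)))%:~R
       * mbar p m * (lucas_u 4 m `|(p%:Z - jacobi (4 - m) p)%R|)%:~R)
  /\
  rat_congr p (p ^ 2)
    (\sum_(0 <= k < ((p ^ a - 1) %/ 2).+1) catalan k / m%:~R ^+ k)
    ((4 - m%:~R) / 2
       * (\sum_(0 <= k < ((p ^ a - 1) %/ 2).+1) 'C(k.*2, k)%:R / m%:~R ^+ k)
     + m%:~R / 2
     - 2 * p%:R * (a == 1%N)%:R * (jacobi (- m) p)%:~R).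
Proof.
case: a a_gt0 => // b _; rewrite [(b.+1 - 1)%N]subn1 [b.+1.-1]/=.
set N := ((_ - 1) %/ 2)%N.
have qE : (p ^ b.+1 = N.*2.+1)%N.
  have : odd (p ^ b.+1) by rewrite oddX p_odd orbT.
  by rewrite /N; move: (p ^ b.+1)%N => q; lia.
have m0 : m%:~R != 0 :> rat.
  by rewrite intr_eq0; apply: contraNneq p_ndvd_m => ->; rewrite dvdz0.
have S1 := central_bin_sum_congr p_prime p_odd p_ndvd_m qE.
have pR := p_integral_lucas_rhs p_prime p_ndvd_m.
rewrite !jacobi_prime_pow // !jacobi_prime //.
set S := \sum_(0 <= k < N.+1) 'C(k.*2, k)%:R / _ in S1 *.
(* With a = b + 1, expanding this product gives chi^a + s chi^(a-1) w, the two terms of the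
   claim. *)
have first : rat_congr p (p ^ 2) S
    ((legendre (m * (m - 4)) p ^+ b)%:~R
       * ((legendre (m * (m - 4)) p)%:~R + (legendre (- m) p)%:~R
         * (mbar p m * (lucas_u 4 m `|(p%:Z - legendre (4 - m) p)%R|)%:~R))).
  apply: rat_congr_p2 => //; last by rewrite rmorphXn.
  by apply: p_integralM => //; apply: p_integral_int.
split.
  move: first; congr rat_congr.
  by rewrite !rmorphXn exprS /=; ring.
have [pS _ _] := first.
have p2V : p_integral p 2^-1.
  by apply: (p_integral_inv p_prime (c := 2)); apply: odd_prime_ndvd2.
have pint := p_integral_int p_prime.
have := bin_prime_pow_half_congr p_prime p_odd p_ndvd_m qE => binE.
apply: rat_congr_p2 => //.
  have pN := p_integralN p_prime; have pM := p_integralM p_prime.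
  apply: p_integralD => //; first apply: p_integralD => //.
  - apply: (pM) => //; apply: (pM) => //.
    by have := pint (4 - m); rewrite rmorphB.
  - exact: pM.
  - apply/pN/pM => //; apply: (pM); last exact: (pint (b.+1 == 1%N)%:Z).
    by apply: pM; [exact: (pint 2) | exact: (pint p)].
rewrite catalan_sum //; apply: congr_p2D => //; first exact: congr_p2_refl.
by have := congr_p2Ml p_prime (pint (-1)) binE; rewrite rmorphN1 !mulN1r.
Qed.
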